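(* Let $(u_h^n,\bar u_h^n,p_h^n,\bar p_h^n)\in V_h\times\bar V_h\times Q_h\times\bar Q_h$ and $(u_h^{n+1},\bar u_h^{n+1},p_h^{n+1},\bar p_h^{n+1})\in V_h\times\bar V_h\times Q_h\times\bar Q_h$ satisfy the fully-discrete problem (D1)--(D4) given in the context. Then $$\int_K\frac{u_h^{n+1}-u_h^n}{\Delta t^n}\,dx=\int_Kf^{n+\theta}\,dx-\int_{\partial K}\hat\sigma_h^{n+\theta}n\,ds\qquad\forall K\in\mathcal T.$$ Furthermore, if $\Gamma_D=\emptyset$, then $$\sum_K\int_K\frac{u_h^{n+1}-u_h^n}{\Delta t^n}\,dx=\sum_K\int_Kf^{n+\theta}\,dx-\int_{\partial\Omega}(1-\lambda)(\bar u_h^n\cdot n)\,\bar u_h^{n+\theta}\,ds-\int_{\partial\Omega}h^{n+\theta}\,ds.$$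
   Context: Setting. $\Omega\subset\mathbb R^d$ is a polygonal ($d=2$) or polyhedral ($d=3$) domain with outward unit normal $n$; $\partial\Omega=\Gamma_D\cup\Gamma_N$ with $\Gamma_D\cap\Gamma_N=\emptyset$; $\nu>0$ is the kinematic viscosity. $\mathcal T=\{K\}$ is a triangulation of $\Omega$ into non-overlapping simplices $K$; $n$ also denotes the outward unit normal on $\partial K$ (as a superscript, $n$ is the time-level index); $h_K$ is the size (diameter) of $K$. Two adjacent cells $K^+,K^-$ share an interior facet $F=\partial K^+\cap\partial K^-$; a facet of $\partial K$ lying on $\partial\Omega$ is a boundary facet. $\mathcal F$ is the set of all (interior and boundary) facets. Spaces. $P_l(D)$ denotes polynomials of degree (at most) $l$ on $D$, and $k\ge2$ is an integer. $V_h=\{v_h\in[L^2(\mathcal T)]^d: v_h|_K\in[P_k(K)]^d\ \forall K\in\mathcal T\}$; $\bar V_h=\{\bar v_h\in[L^2(\mathcal F)]^d:\bar v_h|_F\in[P_k(F)]^d\ \forall F\in\mathcal F,\ \bar v_h=0\text{ on }\Gamma_D\}$; $Q_h=\{q_h\in L^2(\mathcal T): q_h|_K\in P_{k-1}(K)\ \forall K\in\mathcal T\}$; $\bar Q_h=\{\bar q_h\in L^2(\mathcal F):\bar q_h|_F\in P_k(F)\ \forall F\in\mathcal F\}$. Functions in $\bar V_h,\bar Q_h$ live only on facets and are single-valued there; functions in $V_h,Q_h$ may be discontinuous across facets, and in integrals over $\partial K$ their traces from inside $K$ are used. Time discretization. $0=t^0<t^1<\dots<t^N$ are time levels, $\Delta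 t^n=t^{n+1}-t^n$, and for the parameter $\theta$ of the $\theta$-method, $y^{n+\theta}=(1-\theta)y^n+\theta y^{n+1}$. Fluxes. $(a\otimes b)_{ij}=a_ib_j$, $(\nabla u)_{ij}=\partial u_i/\partial x_j$, $\mathbb I$ is the identity tensor. $\sigma_h^{n+\theta}=\sigma_{a,h}^{n+\theta}+\sigma_{d,h}^{n+\theta}$ with $\sigma_{a,h}^{n+\theta}=u_h^{n+\theta}\otimes u_h^n$ and $\sigma_{d,h}^{n+\theta}=p_h^{n+\theta}\mathbb I-\nu\nabla u_h^{n+\theta}$. $\hat\sigma_h^{n+\theta}=\hat\sigma_{a,h}^{n+\theta}+\hat\sigma_{d,h}^{n+\theta}$ with $\hat\sigma_{a,h}^{n+\theta}=\sigma_{a,h}^{n+\theta}+(\bar u_h^{n+\theta}-u_h^{n+\theta})\otimes\lambda u_h^n$ and $\hat\sigma_{d,h}^{n+\theta}=\bar p_h^{n+\theta}\mathbb I-\nu\nabla u_h^{n+\theta}-\frac{\nu\alpha}{h_K}(\bar u_h^{n+\theta}-u_h^{n+\theta})\otimes n$, where $\lambda=1$ on parts of cell boundaries with $u_h^n\cdot n<0$, $\lambda=0$ where $u_h^n\cdot n\ge0$, and $\alpha>0$ is a penalty parameter. Fully-discrete problem: given $(u_h^n,\bar u_h^n,p_h^n,\bar p_h^n)\in V_h\times\bar V_h\times Q_h\times\bar Q_h$ at time $t^n$, $f^{n+\theta}\in[L^2(\Omega)]^d$ and $h^{n+\theta}\in[L^2(\Gamma_N)]^d$, find $(u_h^{n+1},\bar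 u_h^{n+1},p_h^{n+1},\bar p_h^{n+1})\in V_h\times\bar V_h\times Q_h\times\bar Q_h$ such that for all $(v_h,\bar v_h,q_h,\bar q_h)\in V_h\times\bar V_h\times Q_h\times\bar Q_h$: (D1) $0=\sum_K\int_Ku_h^{n+1}\cdot\nabla q_h\,dx-\sum_K\int_{\partial K}u_h^{n+1}\cdot n\,q_h\,ds$; (D2) $0=\sum_K\int_{\partial K}u_h^{n+1}\cdot n\,\bar q_h\,ds-\int_{\partial\Omega}\bar u_h^{n+1}\cdot n\,\bar q_h\,ds$; (D3) $\int_\Omega f^{n+\theta}\cdot v_h\,dx=\int_\Omega\frac{u_h^{n+1}-u_h^n}{\Delta t^n}\cdot v_h\,dx-\sum_K\int_K\sigma_h^{n+\theta}:\nabla v_h\,dx+\sum_K\int_{\partial K}\hat\sigma_h^{n+\theta}:(v_h\otimes n)\,ds+\sum_K\int_{\partial K}\nu\,((\bar u_h^{n+\theta}-u_h^{n+\theta})\otimes n):\nabla v_h\,ds$; (D4) $\int_{\Gamma_N}h^{n+\theta}\cdot\bar v_h\,ds=\sum_K\int_{\partial K}\hat\sigma_h^{n+\theta}:(\bar v_h\otimes n)\,ds-\int_{\Gamma_N}(1-\lambda)(\bar u_h^n\cdot n)\,\bar u_h^{n+\theta}\cdot\bar v_h\,ds$. *)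

(* Defs.v *)
From HB Require Import structures.
From mathcomp Require Import all_boot all_order all_algebra.
(* The notations of mpoly clash with those of mathcomp-analysis. *)
From mathcomp Require Import -(notations) mpoly.
From mathcomp Require Import all_classical all_reals all_analysis.

Set Implicit Arguments.
Unset Strict Implicit.
Unset Printing Implicit Defensive.
Import Order.TTheory GRing.Theory Num.Theory.
Import numFieldNormedType.Exports.
Local Open Scope classical_set_scope.
Local Open Scope ring_scope.

Section Tensors.
Variables (R : realType) (d : nat).
Implicit Types (a b : 'rV[R]_d) (A B : 'M[R]_d).

(* The norm of the library on ['rV[R]_d] is the sup norm, hence [enorm]. *)
Definition dot a b : R := \sum_i a 0 i * b 0 i.
Definition enorm a : R := Num.sqrt (dot a a).
Definition outer a b : 'M[R]_d := a^T *m b.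
Definition frob A B : R := \sum_i \sum_j A i j * B i j.
(* The vector with components [\sum_j A i j * a 0 j]. *)
Definition tapp A a : 'rV[R]_d := a *m A^T.

End Tensors.

Section Lebesgue.
Variable R : realType.

Definition tcons (d : nat)
    (p : measurableTypeR R * d.-tuple (measurableTypeR R)) :
  d.+1.-tuple (measurableTypeR R) := [tuple of p.1 :: p.2].

Lemma measurable_tcons d : measurable_fun setT (@tcons d).
Proof. exact: measurable_cons. Qed.

Section LebesgueS.
Variables (d : nat) (mu : {measure set (d.-tuple (measurableTypeR R)) -> \bar R}).

Definition lebS (A : set (d.+1.-tuple (measurableTypeR R))) : \bar R :=
  (@lebesgue_measure R \x^ mu)%E (@tcons d @^-1` A).

Let mtcons := @measurable_tcons d.

Let lebS0 : lebS set0 = 0%E.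
Proof. by rewrite /lebS preimage_set0 measure0. Qed.

Let lebS_ge0 A : (0 <= lebS A)%E.
Proof. exact: measure_ge0. Qed.

Let lebS_sigma_additive : semi_sigma_additive lebS.
Proof.
move=> F mF tF mUF; rewrite /lebS preimage_bigcup.
apply: measure_semi_sigma_additive.
- by move=> n; rewrite -[X in measurable X]setTI; exact: mtcons.
- apply/trivIsetP => /= i j _ _ ij; rewrite -preimage_setI.
  by move/trivIsetP : tF => /(_ _ _ _ _ ij) ->//; rewrite preimage_set0.
- by rewrite -preimage_bigcup -[X in measurable X]setTI; exact: mtcons.
Qed.

HB.instance Definition _ :=
  isMeasure.Build _ _ _ lebS lebS0 lebS_ge0 lebS_sigma_additive.
End LebesgueS.

(* d-dimensional Lebesgue measure on the Borel sets: the d-fold product of the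
   one-dimensional one. The product [\x^] only asks its left factor to be
   sigma-finite. *)
Fixpoint leb (d : nat) :
    {measure set (d.-tuple (measurableTypeR R)) -> \bar R} :=
  match d with
  | 0 => dirac [tuple]
  | d'.+1 => lebS (leb d')
  end.

Definition vec (d : nat) (t : d.-tuple (measurableTypeR R)) : 'rV[R]_d :=
  \row_i tnth t i.

Definition vint (d : nat) (D : set 'rV[R]_d) (g : 'rV[R]_d -> R) : R :=
  \int[leb d]_(t in @vec d @^-1` D) g (vec t).

Definition vintv (d : nat) (D : set 'rV[R]_d) (g : 'rV[R]_d -> 'rV[R]_d) :
    'rV[R]_d :=
  \row_i vint D (fun x => g x 0 i).

(* Every class of square-integrable functions has a Borel representative. *)
Definition L2 (d : nat) (D : set 'rV[R]_d) (g : 'rV[R]_d -> 'rV[R]_d) :=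
  forall i, measurable_fun (@vec d @^-1` D) (fun t => g (vec t) 0 i) /\
    (\int[leb d]_(t in @vec d @^-1` D) ((g (vec t) 0 i) ^+ 2)%:E < +oo)%E.

End Lebesgue.

Section Simplices.
Variables (R : realType) (d m : nat).
Implicit Types (q : 'I_m.+1 -> 'rV[R]_d) (I : set 'I_m.+1).

(* Relative interior of the simplex with vertices [q]. *)
Definition osimplex q : set 'rV[R]_d :=
  [set x | exists w : 'I_m.+1 -> R, [/\ forall i, 0 < w i,
     \sum_i w i = 1 & x = \sum_i w i *: q i]].

(* Closed face of the simplex spanned by the vertices with index in [I]. *)
Definition cface q I : set 'rV[R]_d :=
  [set x | exists w : 'I_m.+1 -> R, [/\ forall i, 0 <= w i,
     (forall i, ~ I i -> w i = 0), \sum_i w i = 1 & x = \sum_i w i *: q i]].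

Definition edges q : 'M[R]_(m, d) := \matrix_(i < m) (q (lift ord0 i) - q ord0).

Definition affinely_independent q := row_free (edges q).

Definition chart q (t : m.-tuple (measurableTypeR R)) : 'rV[R]_d :=
  q ord0 + vec t *m edges q.

(* m-dimensional volume element of the affine map [chart q]. *)
Definition jac q : R := Num.sqrt (\det (edges q *m (edges q)^T)).

Definition sdom q (A : set 'rV[R]_d) : set (m.-tuple (measurableTypeR R)) :=
  chart q @^-1` (osimplex q `&` A).

(* Integral over [osimplex q `&` A] for the m-dimensional surface measure. *)
Definition sint q (A : set 'rV[R]_d) (g : 'rV[R]_d -> R) : R :=
  jac q * \int[leb R m]_(t in sdom q A) g (chart q t).

End Simplices.

Section Meshes.
Variables (R : realType) (d : nat).

Definition bnd (A : set 'rV[R]_d) : set 'rV[R]_d := closure A `\` A°.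

Record mesh := Mesh { cell : finType; vtx : cell -> 'I_d.+1 -> 'rV[R]_d }.

Variable M : mesh.
Implicit Types (c : cell M) (j : 'I_d.+1).

(* Cells and facets are relatively open; [facet c j] is the facet of [c]
   opposite to the vertex [vtx c j]. *)
Definition K c : set 'rV[R]_d := osimplex (vtx c).

(* [bump j] enumerates the indices other than [j]; for [0 < d] the index type is
   ['I_d], written so that it is visibly nonempty. *)
Definition fvtx c j (i : 'I_d.-1.+1) : 'rV[R]_d := vtx c (inord (bump j i)).

Definition facet c j : set 'rV[R]_d := osimplex (fvtx c j).

Definition diam c : R :=
  sup [set r | exists x y, [/\ K c x, K c y & r = enorm (x - y)]].

Definition outer_unit_normal c j (n : 'rV[R]_d) :=
  [/\ dot n n = 1,
      forall i i', i != j -> i' != j -> dot n (vtx c i - vtx c i') = 0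
    & forall i, i != j -> dot n (vtx c j - vtx c i) < 0].

Definition nrm c j : 'rV[R]_d := xget 0 [set n | outer_unit_normal c j n].

Lemma nrmP c j : (0 < d)%N -> affinely_independent (vtx c) ->
  outer_unit_normal c j (nrm c j).
Proof.
move=> d0 /row_freeP[B EB]; apply: xgetPex.
pose val (i : 'I_d.+1) : R := (i == j)%:R.
pose b : 'cV[R]_d := \col_i (val (lift ord0 i) - val ord0).
pose g : 'rV[R]_d := (B *m b)^T.
have dotE (a v : 'rV[R]_d) : dot a v = (v *m a^T) 0 0.
  by rewrite /dot mxE; apply: eq_bigr => i _; rewrite !mxE mulrC.
have gE i : dot g (vtx c i - vtx c ord0) = val i - val ord0.
  rewrite dotE trmxK mulmxA; case: (unliftP ord0 i) => [l ->|->]; last first.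
    by rewrite !subrr !mul0mx mxE.
  have -> : vtx c (lift ord0 l) - vtx c ord0 = row l (edges (vtx c)).
    by apply/rowP => a; rewrite !mxE.
  by rewrite -row_mul EB -row_mul mul1mx !mxE.
have gD i i' : dot g (vtx c i - vtx c i') = val i - val i'.
  have -> : vtx c i - vtx c i' =
      (vtx c i - vtx c ord0) - (vtx c i' - vtx c ord0).
    by rewrite opprB addrA subrK.
  rewrite dotE mulmxBl mxE [X in _ + X]mxE -!dotE !gE.
  by rewrite opprB addrA subrK.
have [i ij] : exists i, i != j.
  by exists (lift j (Ordinal d0)); rewrite eq_sym neq_lift.
have g0 : 0 < dot g g.
  rewrite lt_neqAle eq_sym andbC sumr_ge0 => [|l _]; last by rewrite -expr2 sqr_ge0.
  apply: contraT => /negPn; rewrite psumr_eq0 => [/allP gz|l _]; last first.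
    by rewrite -expr2 sqr_ge0.
  have : dot g (vtx c i - vtx c j) = 0.
    rewrite /dot big1// => l _.
    by have := gz l (mem_index_enum _); rewrite -expr2 sqrf_eq0 => /eqP ->; rewrite mul0r.
  by rewrite gD /val (negbTE ij) eqxx sub0r => /eqP; rewrite oppr_eq0 oner_eq0.
pose s := (Num.sqrt (dot g g))^-1.
have s0 : 0 < s by rewrite invr_gt0 sqrtr_gt0.
have dotZ (r : R) (a v : 'rV[R]_d) : dot (r *: a) v = r * dot a v.
  by rewrite /dot big_distrr/=; apply: eq_bigr => l _; rewrite mxE mulrA.
have dotC (a v : 'rV[R]_d) : dot a v = dot v a.
  by apply: eq_bigr => l _; rewrite mulrC.
exists (- s *: g); split.
- rewrite dotZ dotC dotZ mulrA mulrNN -expr2 exprVn sqr_sqrtr ?ltW//.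
  by rewrite mulVf// gt_eqF.
- by move=> a a' aj aj'; rewrite dotZ gD /val (negbTE aj) (negbTE aj') subrr mulr0.
- move=> a aj; rewrite dotZ gD /val eqxx (negbTE aj) subr0 mulr1.
  by rewrite oppr_lt0.
Qed.

(* The condition [Omega = (closure Omega)°] excludes slits, across which an
   outward normal on the boundary would be ambiguous. Together with the
   existence of a triangulation this says that [Omega] is a polygonal or
   polyhedral domain. *)
Definition domain (Omega : set 'rV[R]_d) :=
  [/\ open Omega, connected Omega, Omega !=set0 & Omega = (closure Omega)°].

Definition triangulation (Omega : set 'rV[R]_d) :=
  [/\ forall c, affinely_independent (vtx c),
      forall c, K c `<=` Omega,
      closure Omega = \bigcup_c closure (K c),
      forall c c', c != c' -> K c `&` K c' = set0
    & forall c c', c != c' ->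
        cface (vtx c) setT `&` cface (vtx c') setT =
        cface (vtx c) [set i | exists i', vtx c i = vtx c' i']].

Definition boundary_facet (Omega : set 'rV[R]_d) c j : bool :=
  `[< facet c j `<=` bnd Omega >].

Definition boundary_splitting (Omega GammaD GammaN : set 'rV[R]_d) :=
  [/\ GammaD `|` GammaN = bnd Omega, GammaD `&` GammaN = set0,
      measurable (@vec R d @^-1` GammaD) & measurable (@vec R d @^-1` GammaN)].

(* Integrands carry the cell and the facet, as traces and normals depend on the
   side from which a facet is approached. *)
Definition cell_bd_int c (g : 'I_d.+1 -> 'rV[R]_d -> R) : R :=
  \sum_j sint (fvtx c j) setT (g j).

Definition skel_int (g : cell M -> 'I_d.+1 -> 'rV[R]_d -> R) : R :=
  \sum_c cell_bd_int c (g c).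

Definition bd_int (Omega A : set 'rV[R]_d)
    (g : cell M -> 'I_d.+1 -> 'rV[R]_d -> R) : R :=
  \sum_c \sum_(j | boundary_facet Omega c j) sint (fvtx c j) A (g c j).

Definition cell_bd_intv c (g : 'I_d.+1 -> 'rV[R]_d -> 'rV[R]_d) : 'rV[R]_d :=
  \row_i cell_bd_int c (fun j x => g j x 0 i).

Definition bd_intv (Omega A : set 'rV[R]_d)
    (g : cell M -> 'I_d.+1 -> 'rV[R]_d -> 'rV[R]_d) : 'rV[R]_d :=
  \row_i bd_int Omega A (fun c j x => g c j x 0 i).

Definition L2bd (Omega A : set 'rV[R]_d) (g : 'rV[R]_d -> 'rV[R]_d) :=
  forall c j i, boundary_facet Omega c j ->
    measurable_fun (sdom (fvtx c j) A) (fun t => g (chart (fvtx c j) t) 0 i) /\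
    (\int[leb R d.-1]_(t in sdom (fvtx c j) A)
        ((g (chart (fvtx c j) t) 0 i) ^+ 2)%:E < +oo)%E.

End Meshes.

Section Spaces.
Variables (R : realType) (d : nat) (M : mesh R d).

Notation poly := (mpoly d R).

(* [mmeasure mdeg p] is one plus the total degree of [p]. *)
Definition deg_le (l : nat) (p : poly) := (mmeasure (@mdeg d) p <= l.+1)%N.

Definition ev (p : poly) (x : 'rV[R]_d) : R := meval (fun i => x 0 i) p.

Definition evv (v : 'I_d -> poly) (x : 'rV[R]_d) : 'rV[R]_d :=
  \row_i ev (v i) x.

Definition gradS (q : poly) (x : 'rV[R]_d) : 'rV[R]_d :=
  \row_j ev (mderiv j q) x.

Definition gradV (v : 'I_d -> poly) (x : 'rV[R]_d) : 'M[R]_d :=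
  \matrix_(i, j) ev (mderiv j (v i)) x.

(* A piecewise polynomial is given by its polynomial on each cell, whose values
   on the boundary of the cell are the traces from inside; a function on facets
   is a function on R^d of which only the values on facets matter. *)
Definition bvec := cell M -> 'I_d -> poly.
Definition bscal := cell M -> poly.
Definition fvec := 'rV[R]_d -> 'rV[R]_d.
Definition fscal := 'rV[R]_d -> R.

(* The function on R^d, zero outside the cells, defined by a piecewise
   polynomial. *)
Definition glob (v : bvec) (x : 'rV[R]_d) : 'rV[R]_d :=
  \sum_(c | `[< K c x >]) evv (v c) x.

Definition Vh (k : nat) (v : bvec) := forall c i, deg_le k (v c i).

Definition Qh (k : nat) (q : bscal) := forall c, deg_le k.-1 (q c).

(* The restrictions to a facet of the polynomials on R^d of degree at most [k]
   are the polynomials of degree at most [k] on that facet. *)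
Definition Vbarh (k : nat) (GammaD : set 'rV[R]_d) (v : fvec) :=
  (forall c : cell M, forall j, exists p : 'I_d -> poly,
     (forall i, deg_le k (p i)) /\
     (forall x, facet c j x -> v x = evv p x)) /\
  (forall c : cell M, forall j,
     {ae leb R d.-1, forall t, sdom (fvtx c j) GammaD t ->
        v (chart (fvtx c j) t) = 0}).

Definition Qbarh (k : nat) (q : fscal) :=
  forall c : cell M, forall j, exists2 p : poly, deg_le k p &
    forall x, facet c j x -> q x = ev p x.

Record state := State { su : bvec; sub : fvec; sp : bscal; spb : fscal }.

Definition in_spaces k GammaD (s : state) :=
  [/\ Vh k (su s), Vbarh k GammaD (sub s), Qh k (sp s) & Qbarh k (spb s)].

Definition mix (V : lmodType R) (theta : R) (y0 y1 : V) : V :=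
  (1 - theta) *: y0 + theta *: y1.

Definition mix_state (theta : R) (s0 s1 : state) : state :=
  State (fun c i => mix theta (su s0 c i) (su s1 c i))
        (fun x => mix theta (sub s0 x) (sub s1 x))
        (fun c => mix theta (sp s0 c) (sp s1 c))
        (fun x => mix theta (spb s0 x : R^o) (spb s1 x : R^o)).

End Spaces.

Section Scheme.
Variables (R : realType) (d : nat) (M : mesh R d).
Variables (nu alpha : R).
(* [u0] is the velocity at the old time level, [s] the state at the
   intermediate level. *)
Variables (u0 : bvec M) (s : state M).
Implicit Types (c : cell M) (j : 'I_d.+1) (x : 'rV[R]_d).

Definition lambda c j x : R :=
  if dot (evv (u0 c) x) (nrm c j) < 0 then 1 else 0.

Definition sigma_a c x : 'M[R]_d := outer (evv (su s c) x) (evv (u0 c) x).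

Definition sigma_d c x : 'M[R]_d :=
  (ev (sp s c) x)%:M - nu *: gradV (su s c) x.

Definition sigma c x : 'M[R]_d := sigma_a c x + sigma_d c x.

Definition jump c x : 'rV[R]_d := sub s x - evv (su s c) x.

Definition sigmahat_a c j x : 'M[R]_d :=
  sigma_a c x + outer (jump c x) (lambda c j x *: evv (u0 c) x).

Definition sigmahat_d c j x : 'M[R]_d :=
  (spb s x)%:M - nu *: gradV (su s c) x
  - (nu * alpha / diam c) *: outer (jump c x) (nrm c j).

Definition sigmahat c j x : 'M[R]_d := sigmahat_a c j x + sigmahat_d c j x.

End Scheme.

Section Problem.
Variables (R : realType) (d : nat) (M : mesh R d) (k : nat).
Variables (Omega GammaD GammaN : set 'rV[R]_d) (nu alpha theta dt : R).
Variables (f h : 'rV[R]_d -> 'rV[R]_d) (s0 s1 : state M).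

Let u0 := su s0.
Let u1 := su s1.
Let sth := mix_state theta s0 s1.

Definition D1 (q : bscal M) : Prop :=
  0 = \sum_c vint (K c) (fun x => dot (evv (u1 c) x) (gradS (q c) x))
      - skel_int (fun c j x => dot (evv (u1 c) x) (nrm c j) * ev (q c) x).

Definition D2 (qb : fscal R d) : Prop :=
  0 = skel_int (fun c j x => dot (evv (u1 c) x) (nrm c j) * qb x)
      - bd_int Omega (bnd Omega)
          (fun (c : cell M) j x => dot (sub s1 x) (nrm c j) * qb x).

Definition D3 (v : bvec M) : Prop :=
  vint Omega (fun x => dot (f x) (glob v x)) =
    vint Omega (fun x => dot (dt^-1 *: (glob u1 x - glob u0 x)) (glob v x))
    - \sum_c vint (K c) (fun x => frob (sigma nu u0 sth c x) (gradV (v c) x))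
    + skel_int (fun c j x =>
        frob (sigmahat nu alpha u0 sth c j x) (outer (evv (v c) x) (nrm c j)))
    + skel_int (fun c j x =>
        nu * frob (outer (jump sth c x) (nrm c j)) (gradV (v c) x)).

(* On the boundary of [Omega], [lambda] is evaluated with the trace of the old
   velocity from the only cell adjacent to the facet. *)
Definition D4 (vb : fvec R d) : Prop :=
  bd_int Omega GammaN (fun (_ : cell M) _ x => dot (h x) (vb x)) =
    skel_int (fun c j x =>
      frob (sigmahat nu alpha u0 sth c j x) (outer (vb x) (nrm c j)))
    - bd_int Omega GammaN (fun c j x =>
        (1 - lambda u0 c j x) * dot (sub s0 x) (nrm c j)
        * dot (sub sth x) (vb x)).

Definition fully_discrete : Prop :=
  forall (v : bvec M) (vb : fvec R d) (q : bscal M) (qb : fscal R d),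
    Vh k v -> Vbarh M k GammaD vb -> Qh k q -> Qbarh M k qb ->
    [/\ D1 q, D2 qb, D3 v & D4 vb].

End Problem.

(* Main.v *)
Require Import Defs.
From mathcomp Require Import all_boot all_order all_algebra.
From mathcomp Require Import -(notations) mpoly.
From mathcomp Require Import all_classical all_reals all_analysis.

Set Implicit Arguments.
Unset Strict Implicit.
Unset Printing Implicit Defensive.
Import Order.TTheory GRing.Theory Num.Theory.
Local Open Scope classical_set_scope.
Local Open Scope ring_scope.

(** The scheme is tested with piecewise constants.  For a cell [c] and a
coordinate [i], let [v_h] be the [i]-th unit vector on [c] and zero on the other
cells.  This is an element of [V_h] because [V_h] is discontinuous, its gradient
vanishes, and the momentum equation (D3) for it is the [i]-th component of the
local balance on [c].

If [GammaD] is empty, the constant [i]-th unit vector is admissible as a facet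
test function, and (D4) says that the numerical fluxes through all cell
boundaries add up to the boundary data and the outflow through the boundary of
[Omega].  The global balance is the sum of the local ones over all cells.

Both steps are identities between integrals over equal sets of equal integrands:
no integrability, and not even additivity of the integral, is needed. *)

(** * Tensor identities *)

Section TensorIdentities.
Variables (R : realType) (d : nat).
Implicit Types (a b : 'rV[R]_d) (A : 'M[R]_d).

Lemma dot0r a : dot a 0 = 0.
Proof. by rewrite /dot big1// => i _; rewrite mxE mulr0. Qed.

Lemma dot_delta a (i : 'I_d) : dot a (delta_mx 0 i) = a 0 i.
Proof.
rewrite /dot (bigD1 i)//= mxE !eqxx mulr1 big1 ?addr0// => j ji.
by rewrite mxE (negbTE ji) andbF mulr0.
Qed.

Lemma frob0r A : frob A 0 = 0.
Proof. by rewrite /frob big1// => i _; rewrite big1// => j _; rewrite mxE mulr0. Qed.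

Lemma frob_outer A a b : frob A (outer a b) = dot (tapp A b) a.
Proof.
rewrite /frob /dot; apply: eq_bigr => i _; rewrite /tapp mxE big_distrl/=.
apply: eq_bigr => j _; rewrite /outer !mxE big_ord1 !mxE.
by rewrite mulrCA mulrC [A i j * _]mulrC.
Qed.

End TensorIdentities.

(** * Congruence and restriction of integrals *)

Section Integrals.
Variables (R : realType) (d : nat).

Lemma eq_vint (D : set 'rV[R]_d) (g1 g2 : 'rV[R]_d -> R) :
  (forall x, D x -> g1 x = g2 x) -> vint D g1 = vint D g2.
Proof.
by move=> E; apply: eq_Rintegral => t; rewrite inE => Dt; exact: E.
Qed.

Lemma vint0 (D : set 'rV[R]_d) : vint D (fun=> 0) = 0.
Proof. by rewrite /vint /Rintegral integral0. Qed.

(** Neither set nor integrand has to be measurable: the integral over a set is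
the integral over the whole space of the extension by zero. *)
Lemma vint_subset (A D : set 'rV[R]_d) (g : 'rV[R]_d -> R) : A `<=` D ->
  (forall x, ~ A x -> g x = 0) -> vint D g = vint A g.
Proof.
move=> AD g0; rewrite /vint /Rintegral; congr fine.
rewrite integral_mkcond [RHS]integral_mkcond; congr integral.
apply/funext => t; rewrite !patchE.
have [Dt|Dt] := boolP (t \in _); have [At|At] := boolP (t \in _) => //.
- by rewrite g0// => At'; move/negP: At; apply; rewrite inE.
- by exfalso; move/negP: Dt; apply; move: At; rewrite !inE => /AD.
Qed.

Lemma eq_sint (m : nat) (q : 'I_m.+1 -> 'rV[R]_d) A (g1 g2 : 'rV[R]_d -> R) :
  g1 =1 g2 -> sint q A g1 = sint q A g2.
Proof. by move=> /funext ->. Qed.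

Lemma sint0 (m : nat) (q : 'I_m.+1 -> 'rV[R]_d) A : sint q A (fun=> 0) = 0.
Proof. by rewrite /sint /Rintegral integral0 mulr0. Qed.

Variable M : mesh R d.

Lemma eq_cell_bd_int (c : cell M) (g1 g2 : 'I_d.+1 -> 'rV[R]_d -> R) :
  (forall j x, g1 j x = g2 j x) -> cell_bd_int c g1 = cell_bd_int c g2.
Proof. by move=> E; apply: eq_bigr => j _; exact: eq_sint. Qed.

Lemma cell_bd_int0 (c : cell M) (g : 'I_d.+1 -> 'rV[R]_d -> R) :
  (forall j x, g j x = 0) -> cell_bd_int c g = 0.
Proof.
move=> E; rewrite /cell_bd_int big1// => j _.
by rewrite (eq_sint _ _ (E j)) sint0.
Qed.

Lemma eq_bd_int (Omega A : set 'rV[R]_d)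
    (g1 g2 : cell M -> 'I_d.+1 -> 'rV[R]_d -> R) :
  (forall c j x, g1 c j x = g2 c j x) ->
  bd_int Omega A g1 = bd_int Omega A g2.
Proof. by move=> E; apply: eq_bigr => c _; apply: eq_bigr => j _; exact: eq_sint. Qed.

End Integrals.

(** * Piecewise constant test functions *)

Section TestFunctions.
Variables (R : realType) (d : nat).
Implicit Types (i : 'I_d) (b : bool).

(** The constant polynomial vector field equal to the [i]-th unit vector if [b],
and to zero otherwise. *)
Definition unit_field b i : 'I_d -> mpoly d R :=
  fun i' => mpolyC d (b && (i' == i))%:R.

Lemma deg_le_mpolyC (k : nat) (a : R) : deg_le k (mpolyC d a).
Proof. by rewrite /deg_le mmeasureC; case: eqP. Qed.

Lemma evv_unit_field b i (x : 'rV[R]_d) :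
  evv (unit_field b i) x = if b then delta_mx 0 i else 0.
Proof.
apply/rowP => i'; rewrite mxE /ev /unit_field mevalC.
by case: b => /=; rewrite !mxE.
Qed.

Lemma gradV_unit_field b i (x : 'rV[R]_d) : gradV (unit_field b i) x = 0.
Proof. by apply/matrixP => a a'; rewrite !mxE /unit_field mderivC /ev meval0. Qed.

Variable M : mesh R d.

Lemma glob_unit_field (c : cell M) i (x : 'rV[R]_d) :
  glob (fun c' => unit_field (c' == c) i) x =
  if `[< K c x >] then delta_mx 0 i else 0.
Proof.
rewrite /glob; have [Kx|nKx] := ifPn.
  rewrite (bigD1 c)//= evv_unit_field eqxx big1 ?addr0// => c' /andP[_ c'c].
  by rewrite evv_unit_field (negbTE c'c).
rewrite big1// => c' Kx; rewrite evv_unit_field.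
by case: eqP Kx nKx => // -> ->.
Qed.

(** As the cells are disjoint, at most one term of the sum in [glob] survives. *)
Lemma glob_cell (v : bvec M) (c : cell M) (x : 'rV[R]_d) :
  (forall c c' : cell M, c != c' -> K c `&` K c' = set0) ->
  K c x -> glob v x = evv (v c) x.
Proof.
move=> dK Kx; rewrite /glob (bigD1 c)/=; last exact/asboolP.
rewrite big1 ?addr0// => c' /andP[/asboolP Kx' c'c]; exfalso.
suff : (K c' `&` K c) x by rewrite (dK _ _ c'c).
by split.
Qed.

End TestFunctions.

(** * Local and global momentum balance *)

Section Balances.
Variables (R : realType) (d k : nat) (M : mesh R d).
Variables (Omega GammaD GammaN : set 'rV[R]_d) (nu alpha theta dt : R).
Variables (f h : 'rV[R]_d -> 'rV[R]_d) (s0 s1 : state M).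
Implicit Types (c : cell M) (i : 'I_d).

(** The normal component of the numerical flux through the facet [j] of [c]. *)
Let flux c (j : 'I_d.+1) (x : 'rV[R]_d) : 'rV[R]_d :=
  tapp (sigmahat nu alpha (su s0) (mix_state theta s0 s1) c j x) (nrm c j).

Lemma D3_local_balance c i : triangulation M Omega ->
  D3 Omega nu alpha theta dt f s0 s1 (fun c' => unit_field R (c' == c) i) ->
  vint (K c) (fun x => (dt^-1 *: (evv (su s1 c) x - evv (su s0 c) x)) 0 i) =
  vint (K c) (fun x => f x 0 i) - cell_bd_int c (fun j x => flux c j x 0 i).
Proof.
move=> [_ KO _ dK _]; rewrite /D3.
(* Pairing with the test function extracts the [i]-th component on [c] and
   gives zero on the rest of [Omega]. *)
have restrict (g : 'rV[R]_d -> 'rV[R]_d) :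
    vint Omega (fun x => dot (g x)
      (glob (fun c' => unit_field R (c' == c) i) x)) =
    vint (K c) (fun x => g x 0 i).
  rewrite (vint_subset (KO c)).
    apply: eq_vint => x Kx.
    by rewrite glob_unit_field asboolT// dot_delta.
  by move=> x nKx; rewrite glob_unit_field asboolF// dot0r.
rewrite !restrict => balance.
have volume0 : \sum_c' vint (K c') (fun x =>
    frob (sigma nu (su s0) (mix_state theta s0 s1) c' x)
      (gradV (unit_field R (c' == c) i) x)) = 0.
  rewrite big1// => c' _; rewrite -[RHS](vint0 (K c')); apply: eq_vint => x _.
  by rewrite gradV_unit_field frob0r.
have jump0 : skel_int (fun c' j x =>
    nu * frob (outer (jump (mix_state theta s0 s1) c' x) (nrm c' j))
      (gradV (unit_field R (c' == c) i) x)) = 0.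
  rewrite /skel_int big1// => c' _; apply: cell_bd_int0 => j x.
  by rewrite gradV_unit_field frob0r mulr0.
have fluxE : skel_int (fun c' j x =>
    frob (sigmahat nu alpha (su s0) (mix_state theta s0 s1) c' j x)
      (outer (evv (unit_field R (c' == c) i) x) (nrm c' j))) =
    cell_bd_int c (fun j x => flux c j x 0 i).
  rewrite /skel_int (bigD1 c)//= [X in _ + X]big1 ?addr0.
    apply: eq_cell_bd_int => j x.
    by rewrite frob_outer evv_unit_field eqxx dot_delta.
  move=> c' c'c; apply: cell_bd_int0 => j x.
  by rewrite frob_outer evv_unit_field (negbTE c'c) dot0r.
move: balance; rewrite volume0 jump0 fluxE subr0 addr0 => ->.
rewrite addrK; apply: eq_vint => x Kx.
by rewrite !(glob_cell _ dK Kx).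
Qed.

Lemma D4_global_flux i :
  D4 Omega GammaN nu alpha theta h s0 s1 (fun=> delta_mx 0 i) ->
  \sum_c cell_bd_int c (fun j x => flux c j x 0 i) =
  bd_int Omega GammaN (fun c j x =>
    (((1 - lambda (su s0) c j x) * dot (sub s0 x) (nrm c j))
      *: sub (mix_state theta s0 s1) x) 0 i)
  + bd_int Omega GammaN (fun (_ : cell M) _ x => h x 0 i).
Proof.
rewrite /D4 => balance.
have -> : bd_int Omega GammaN (fun (_ : cell M) _ x => h x 0 i) =
    bd_int Omega GammaN (fun (_ : cell M) _ x => dot (h x) (delta_mx 0 i)).
  by apply: eq_bd_int => c j x; rewrite dot_delta.
rewrite balance addrC.
rewrite [X in _ = _ - X + _](_ : _ = bd_int Omega GammaN (fun c j x =>
    (((1 - lambda (su s0) c j x) * dot (sub s0 x) (nrm c j))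
      *: sub (mix_state theta s0 s1) x) 0 i)); last first.
  by apply: eq_bd_int => c j x; rewrite dot_delta !mxE.
rewrite subrK; apply: eq_bigr => c _; apply: eq_cell_bd_int => j x.
by rewrite frob_outer dot_delta.
Qed.

Lemma Vh_unit_field c i : Vh k (fun c' : cell M => unit_field R (c' == c) i).
Proof. by move=> c' i'; exact: deg_le_mpolyC. Qed.

(** Constants are admissible facet functions because no zero condition is left
when the Dirichlet boundary is empty. *)
Lemma Vbarh_delta i : Vbarh M k set0 (fun=> delta_mx 0 i).
Proof.
split=> c j.
  exists (unit_field R true i); split; first by move=> i'; exact: deg_le_mpolyC.
  by move=> x _; rewrite evv_unit_field.
by apply: aeW => t [].
Qed.

Lemma Vbarh0 : Vbarh M k GammaD (fun=> 0).
Proof.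
split=> c j; last exact: aeW.
exists (fun=> mpolyC d 0); split; first by move=> i'; exact: deg_le_mpolyC.
by move=> x _; apply/rowP => i'; rewrite !mxE /ev mevalC.
Qed.

Lemma Vh0 : Vh k (fun (_ : cell M) _ => mpolyC d (0 : R)).
Proof. by move=> c i; exact: deg_le_mpolyC. Qed.

Lemma Qh0 : Qh k (fun _ : cell M => mpolyC d (0 : R)).
Proof. by move=> c; exact: deg_le_mpolyC. Qed.

Lemma Qbarh0 : Qbarh M k (fun=> 0).
Proof.
move=> c j; exists (mpolyC d 0); first exact: deg_le_mpolyC.
by move=> x _; rewrite /ev mevalC.
Qed.

End Balances.

Theorem proposition5 (R : realType) (d k : nat)
    (hd : d = 2%N \/ d = 3%N) (hk : (2 <= k)%N)
    (Omega GammaD GammaN : set 'rV[R]_d)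
    (hOmega : domain Omega)
    (hGamma : boundary_splitting Omega GammaD GammaN)
    (M : mesh R d) (hM : triangulation M Omega)
    (nu alpha theta : R) (hnu : 0 < nu) (halpha : 0 < alpha)
    (N n : nat) (t : nat -> R) (ht0 : t 0%N = 0)
    (ht : forall i, (i < N)%N -> t i < t i.+1) (hn : (n < N)%N)
    (f h : 'rV[R]_d -> 'rV[R]_d)
    (hf : L2 Omega f) (hh : L2bd M Omega GammaN h)
    (s0 s1 : state M)
    (hs0 : in_spaces k GammaD s0) (hs1 : in_spaces k GammaD s1)
    (hD : fully_discrete k Omega GammaD GammaN nu alpha theta
            (t n.+1 - t n) f h s0 s1) :
  (forall c : cell M,
     vintv (K c)
       (fun x => (t n.+1 - t n)^-1 *: (evv (su s1 c) x - evv (su s0 c) x)) =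
     vintv (K c) f
     - cell_bd_intv c (fun j x =>
         tapp (sigmahat nu alpha (su s0) (mix_state theta s0 s1) c j x)
              (nrm c j)))
  /\
  (GammaD = set0 ->
     \sum_(c : cell M) vintv (K c)
       (fun x => (t n.+1 - t n)^-1 *: (evv (su s1 c) x - evv (su s0 c) x)) =
     \sum_(c : cell M) vintv (K c) f
     - bd_intv Omega (bnd Omega) (fun (c : cell M) j x =>
         ((1 - lambda (su s0) c j x) * dot (sub s0 x) (nrm c j))
           *: sub (mix_state theta s0 s1) x)
     - bd_intv Omega (bnd Omega) (fun (_ : cell M) _ x => h x)).
Proof.
have local c : vintv (K c)
    (fun x => (t n.+1 - t n)^-1 *: (evv (su s1 c) x - evv (su s0 c) x)) =
    vintv (K c) f - cell_bd_intv c (fun j x =>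
      tapp (sigmahat nu alpha (su s0) (mix_state theta s0 s1) c j x) (nrm c j)).
  apply/rowP => i; rewrite !mxE; apply: (D3_local_balance hM).
  by have [] := hD _ _ _ _ (Vh_unit_field k c i) (Vbarh0 k M GammaD)
    (Qh0 k (M:=M)) (Qbarh0 k (M:=M)).
split=> // GammaD0.
have GammaNE : GammaN = bnd Omega.
  by case: hGamma => <- _ _ _; rewrite GammaD0 set0U.
(* After summing the local balances it remains to identify the total flux. *)
rewrite (eq_bigr _ (fun c _ => local c)) sumrB -addrA -opprD; congr (_ - _).
apply/rowP => i; rewrite summxE mxE [in RHS]mxE [X in _ = _ + X]mxE -GammaNE.
rewrite -(D4_global_flux (nu := nu) (alpha := alpha)).
  by apply: eq_bigr => c _; rewrite mxE.
have cst : Vbarh M k GammaD (fun=> delta_mx 0 i).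
  by rewrite GammaD0; exact: Vbarh_delta.
by have [] := hD _ _ _ _ (Vh0 k (M:=M)) cst (Qh0 k (M:=M)) (Qbarh0 k (M:=M)).
Qed.
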